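(* Let $\mathfrak a$ and $\mathfrak b$ be scope functions on the same set $X$. The following are equivalent: (i) $\equiv_{\mathfrak a}\,=\,\equiv_{\mathfrak b}$ as relations on $\mathcal P(X)$; (ii) $K_{\mathfrak a}=K_{\mathfrak b}$ as maps $\mathcal P(X)\to\mathcal P(X)$; (iii) $S_{\mathfrak a}^{\infty}(A)=S_{\mathfrak b}^{\infty}(A)$ for every $A\subseteq X$; (iv) $\preccurlyeq_{\mathfrak a}\,=\,\preccurlyeq_{\mathfrak b}$; (v) $\tau_{\mathfrak a}=\tau_{\mathfrak b}$; (vi) $R_{\mathfrak a}^{*}=R_{\mathfrak b}^{*}$.
   Context: $X$ is a nonempty set. A scope function on $X$ is a map $\mathfrak a:X\to\tau$, where $\tau$ is a topology on $X$, satisfying $x\in\mathfrak a(x)$ for every $x\in X$. A set $U\subseteq X$ is $\mathfrak a$-open if $\{x\in U:\mathfrak a(x)\subseteq U\}=U$; the family of all $\mathfrak a$-open sets is denoted $\tau_{\mathfrak a}$ and is known to be a topology on $X$. The scope relation is $xR_{\mathfrak a}y\iff y\in\mathfrak a(x)$; $R^*$ denotes the reflexive-transitive closure of a relation $R$, and $\preccurlyeq_{\mathfrak a}$ denotes $R_{\mathfrak a}^*$. For $A\subseteq X$: $S_{\mathfrak a}(A)=\bigcup_{x\in A}\mathfrak a(x)$, $S_{\mathfrak a}^0(A)=A$, $S_{\mathfrak a}^{n+1}(A)=S_{\mathfrak a}(S_{\mathfrak a}^n(A))$, $S_{\mathfrak a}^{\infty}(A)=\bigcup_{n\ge0}S_{\mathfrak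 a}^n(A)$. For $A,B\subseteq X$, $A\equiv_{\mathfrak a}B$ means that for every $U\in\tau_{\mathfrak a}$, $A\subseteq U\iff B\subseteq U$. The canonical hull is $K_{\mathfrak a}(A)=\bigcap\{U\in\tau_{\mathfrak a}:A\subseteq U\}$. The same notation is used with $\mathfrak b$ in place of $\mathfrak a$. *)

(* Defs.v *)
From Stdlib Require Import Relation_Operators.
From HB Require Import structures.
From mathcomp Require Import all_boot all_order.
From mathcomp Require Import boolp classical_sets topology.

Set Implicit Arguments.
Unset Strict Implicit.
Unset Printing Implicit Defensive.

Local Open Scope classical_set_scope.

(* A topology on [X] is an inhabitant of the library's class [Topological X],
   rather than a canonical structure on [X], so that several scope functions on
   the same [X] may come with different topologies. *)
Definition opens (X : Type) (t : Topological X) : set_system X :=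
  @open (Topological.Pack t).

Record scope_function (X : Type) := ScopeFunction {
  scope_topology : Topological X;
  scope :> X -> set X;
  scope_opens : forall x, opens scope_topology (scope x);
  scope_mem : forall x, scope x x
}.

Section ScopeTheory.
Variables (X : Type) (a : scope_function X).

Definition scope_tau : set_system X :=
  [set U | [set x | U x /\ a x `<=` U] = U].

Definition scope_rel (x y : X) : Prop := a x y.

Definition scope_preceq : X -> X -> Prop := clos_refl_trans X scope_rel.

Definition scope_step (A : set X) : set X := \bigcup_(x in A) a x.

Definition scope_iter (n : nat) (A : set X) : set X := iter n scope_step A.

Definition scope_infty (A : set X) : set X := \bigcup_n scope_iter n A.

Definition scope_equiv (A B : set X) : Prop :=
  forall U, scope_tau U -> (A `<=` U <-> B `<=` U).

Definition scope_hull (A : set X) : set X := smallest scope_tau A.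

End ScopeTheory.

(* Main.v *)
Require Import Defs.
From Stdlib Require Import Relation_Operators.
From HB Require Import structures.
From mathcomp Require Import all_boot all_order.
From mathcomp Require Import boolp classical_sets topology.

(** The family [scope_tau a] consists of the sets that contain the scope of
each of their points; these are the sets called open below. Each of the other
objects both determines this family and is determined by it.

- Such a set absorbs each further application of [scope_step a], and
  [scope_infty a A] is itself such a set. So [scope_infty a A] is the least
  open set containing [A], that is, the hull of [A] ([scope_infty_hull]).
- The points reachable from [x] likewise form the least open set containing
  [x], so [scope_preceq a x] is the hull of [[set x]] ([scope_preceq_hull]).
- Conversely the open sets are the up-sets of [scope_preceq a]
  ([scope_tau_upset]).
- A point [x] lies in the hull of [A] exactly when adding it to [A] does not
  change which open sets contain the set ([scope_hull_equiv]), so the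
  equivalence on subsets recovers the hull.

In the resulting cycle of implications, equivalence gives hulls, hulls give
[scope_infty], its values on singletons give the preorder, the preorder gives
the open sets, and these give back the hulls of points, hence the preorder, as
well as the equivalence. Each step uses a formula in which the scope function
occurs only through the object already known to agree. *)

Local Open Scope classical_set_scope.

Section OneScope.
Variables (X : Type) (a : scope_function X).

Lemma scope_tauP (U : set X) :
  scope_tau a U <-> forall x, U x -> a x `<=` U.
Proof.
split=> [UE x Ux|Ua]; first by move: Ux; rewrite -{1}UE => -[].
by apply/seteqP; split=> [x []//|x Ux]; split=> //; exact: Ua.
Qed.

(** The scope relation steps inside an open set, so do its finite paths;
conversely a single step is a path. *)
Lemma scope_tau_upset (U : set X) :
  scope_tau a U <-> forall x y, scope_preceq a x y -> U x -> U y.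
Proof.
rewrite scope_tauP; split=> [Ua x y|Ua x Ux y axy]; last first.
  by apply: Ua Ux; exact: rt_step.
by elim=> // [{}x {}y axy /Ua|{}x z {}y _ IHz _ IHy /IHz /IHy//]; exact.
Qed.

(** Reaching one more point takes one more application of [scope_step],
which the union over all iterates already contains. *)
Lemma scope_tau_infty (A : set X) : scope_tau a (scope_infty a A).
Proof.
apply/scope_tauP => x [n _ Ax] y axy.
by exists n.+1 => //; exists x.
Qed.

Lemma scope_infty_min (A U : set X) :
  scope_tau a U -> A `<=` U -> scope_infty a A `<=` U.
Proof.
move=> /scope_tauP Ua AU y [n _].
by elim: n y => [|n IHn] y; [exact: AU|case=> x /IHn /Ua; exact].
Qed.

(** The hull is only an intersection of open sets, so its openness is not at
hand; it is identified from a candidate already known to be open. *)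
Lemma scope_hull_unique (A V : set X) : scope_tau a V -> A `<=` V ->
  (forall U, scope_tau a U -> A `<=` U -> V `<=` U) -> V = scope_hull a A.
Proof.
move=> oV AV Vmin; apply/seteqP; split=> x; last by apply.
by move=> Vx U [oU AU]; exact: Vmin Vx.
Qed.

Lemma scope_infty_hull (A : set X) : scope_infty a A = scope_hull a A.
Proof.
apply: scope_hull_unique; first exact: scope_tau_infty.
  by move=> x Ax; exists 0%N.
exact: scope_infty_min.
Qed.

(** Transitivity makes the set of points above [x] open, and
[scope_tau_upset] puts it inside each open set containing [x]. *)
Lemma scope_preceq_hull (x : X) : scope_preceq a x = scope_hull a [set x].
Proof.
apply: scope_hull_unique.
- by apply/scope_tau_upset => y z yz xy; exact: rt_trans xy yz.
- by move=> _ ->; exact: rt_refl.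
- by move=> U /scope_tau_upset Ua xU y xy; apply: Ua xy _; exact: xU.
Qed.

Lemma scope_hull_equiv (A : set X) (x : X) :
  scope_hull a A x <-> scope_equiv a A (A `|` [set x]).
Proof.
split=> [Ax U oU|Ax U [oU AU]].
  split=> [AU y [/AU//|->]|AxU y Ay]; first exact: Ax.
  by apply: AxU; left.
by apply: (Ax U oU).1 => //; right.
Qed.

End OneScope.

Theorem theorem7p3 (X : Type) (X_nonempty : [set: X] !=set0)
    (a b : scope_function X) :
  [<-> (* i *) scope_equiv a = scope_equiv b;
       (* ii *) scope_hull a = scope_hull b;
       (* iii *) forall A : set X, scope_infty a A = scope_infty b A;
       (* iv *) scope_preceq a = scope_preceq b;
       (* v *) scope_tau a = scope_tau b;
       (* vi *) clos_refl_trans X (scope_rel a) = clos_refl_trans X (scope_rel b)].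
Proof.
have tau_preceq : scope_preceq a = scope_preceq b -> scope_tau a = scope_tau b.
  move=> ab; apply/funext => U; apply/propext.
  by rewrite !scope_tau_upset ab.
tfae.
- move=> ab; apply/funext => A; apply/funext => x; apply/propext.
  by rewrite !scope_hull_equiv ab.
- by move=> ab A; rewrite !scope_infty_hull ab.
- move=> ab; apply/funext => x.
  by rewrite !scope_preceq_hull -!scope_infty_hull ab.
- exact: tau_preceq.
- move=> ab; apply/funext => x; rewrite -!/(scope_preceq _).
  by rewrite !scope_preceq_hull /scope_hull ab.
- by move=> /tau_preceq ab; rewrite /scope_equiv ab.
Qed.
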